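(* Let $A_k<0<B_k$ ($k=1,\dots,n$) be real numbers and let $\phi=\{\phi_k: k=1,2,\dots,n\}$ be a multiplicative system of real random variables on a probability space satisfying $A_k\le\phi_k\le B_k$ for all $k$. Then for every $\lambda>0$, $$\left|\left\{\sum_{k=1}^n\phi_k>\lambda\right\}\right|\le \exp\left(-\frac{2\lambda^2}{\sum_{k=1}^n(B_k-A_k)^2}\right).$$
   Context: $|\{\cdot\}|$ denotes the probability of an event. A system of bounded random variables $\phi_1,\dots,\phi_n$ is multiplicative if $\mathbf{E}[\phi_{n_1}\phi_{n_2}\cdots\phi_{n_\nu}]=0$ for all possible choices of indices $n_1<n_2<\dots<n_\nu$ in $\{1,\dots,n\}$, $\nu\ge1$. *)

(* Defs.v *)
From HB Require Import structures.
From mathcomp Require Import all_boot all_order all_algebra.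
From mathcomp Require Import all_classical all_reals all_analysis.
Import Order.TTheory GRing.Theory Num.Theory.
Import numFieldNormedType.Exports.
Set Implicit Arguments.
Unset Strict Implicit.
Unset Printing Implicit Defensive.

Local Open Scope classical_set_scope.
Local Open Scope ring_scope.

(* A choice of indices n_1 < ... < n_nu with nu >= 1 is encoded by the
   nonempty finite set S of these indices.  Boundedness (up to a null set) is
   part of the notion: it makes every product integrable, so that no
   expectation below takes a default value. *)
Definition multiplicative_system (d : measure_display) (T : measurableType d)
    (R : realType) (P : probability T R) (n : nat)
    (phi : 'I_n -> {RV P >-> R}) : Prop :=
  (forall k : 'I_n, exists M : R, {ae P, forall x, `|phi k x| <= M}) /\
  (forall S : {set 'I_n}, S != finset.set0 ->
    ('E_P[fun x => (\prod_(k in S) phi k x)%R] = 0)%E).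

(* Main.v *)
(* By convexity, exp (t phi_k) lies below its chord a_k + b_k phi_k over [A_k, B_k],
   and the chord is nonnegative there.  Expanding the product of the affine
   functions a_k + b_k phi_k, multiplicativity kills every term but the constant
   one, so E exp (t sum phi_k) <= prod a_k, just as for independent centered
   variables.  Hoeffding's estimate a_k <= exp (t^2 (B_k - A_k)^2 / 8) and Chernoff's
   bound with t = 4 lambda / sum (B_k - A_k)^2 conclude. *)
Require Import Defs.
From HB Require Import structures.
From mathcomp Require Import all_boot all_order all_algebra.
From mathcomp Require Import all_classical all_reals all_analysis.
From mathcomp Require Import measurable_realfun ring lra.
Import Order.TTheory GRing.Theory Num.Theory.
Import numFieldNormedType.Exports.
Local Open Scope classical_set_scope.
Local Open Scope ring_scope.

(** The tangent at [x] lies below [expR] at both endpoints. Weighting these two inequalities by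
    [b - x] and [x - a] cancels the first-order terms. *)
Lemma expR_le_chord (R : realType) (a b x : R) : a < b -> a <= x <= b ->
  expR x <= (b * expR a - a * expR b) / (b - a) + (expR b - expR a) / (b - a) * x.
Proof.
move=> ab /andP[ax xb].
have ba0 : 0 < b - a by lra.
have tangent y : expR x * (1 + (y - x)) <= expR y.
  rewrite -[in leRHS](subrKC x y) expRD ler_pM2l ?expR_gt0//.
  exact: expR_ge1Dx.
have ha : (b - x) * (expR x * (1 + (a - x))) <= (b - x) * expR a.
  by apply: ler_wpM2l => //; lra.
have hb : (x - a) * (expR x * (1 + (b - x))) <= (x - a) * expR b.
  by apply: ler_wpM2l => //; lra.
have -> : (b * expR a - a * expR b) / (b - a) + (expR b - expR a) / (b - a) * x
    = ((b - x) * expR a + (x - a) * expR b) / (b - a) by field; lra.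
rewrite ler_pdivlMr//.
rewrite [leLHS](_ : _ = (b - x) * (expR x * (1 + (a - x))) +
  (x - a) * (expR x * (1 + (b - x)))); last by ring.
exact: lerD.
Qed.

Lemma le_of_is_derive_ge0 (R : realType) (f df : R -> R) :
  (forall x : R, 0 <= x -> is_derive x (1 : R) f (df x)) -> (forall x : R, 0 <= x -> 0 <= df x) ->
  forall x, 0 <= x -> f 0 <= f x.
Proof.
move=> fdf df0 x x0.
apply: (@ger0_derive1_ndecr _ f 0 x) => //.
- by move=> z; rewrite in_itv/= => /andP[/ltW z0 _]; case: (fdf z z0).
- move=> z; rewrite in_itv/= => /andP[/ltW z0 _].
  by rewrite derive1E (@derive_val _ _ _ _ _ _ _ (fdf z z0)) df0.
- apply: derivable_within_continuous => z; rewrite in_itv/= => /andP[z0 _].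
  by case: (fdf z z0).
Qed.

Section centered_bernoulli.
Variables (R : realType) (p : R).
Hypothesis p01 : 0 < p < 1.
(** Moment generating function of a Bernoulli variable of parameter [p]. *)
Let D (h : R) : R := 1 - p + p * expR h.

Let D_gt0 (h : R) : 0 < D h.
Proof.
case/andP: p01 => p0 p1; rewrite /D.
by have := mulr_gt0 p0 (expR_gt0 h); lra.
Qed.

Let dD (h : R) : is_derive h (1 : R) D (p * expR h).
Proof. by rewrite /D; apply: is_derive_eq; rewrite add0r mul1r. Qed.

(* The left-hand side is the derivative of [h ^+ 2 / 8 + p * h - ln (D h)]; its own
   derivative is [1/4 - q (1 - q)] with [q = p * expR h / D h]. *)
Let slope_ge0 (h : R) : 0 <= h -> 0 <= h / 4 + p - 1 + (1 - p) / D h.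
Proof.
move=> h0.
pose f (x : R) : R := x / 4 + p - 1 + (1 - p) / D x.
have f0 : f 0 = 0 by rewrite /f /D expR0; field; lra.
suff : f 0 <= f h by rewrite f0.
apply: (@le_of_is_derive_ge0 _ f (fun x => 4^-1 - (1 - p) * p * expR x / D x ^+ 2) _ _ _ h0).
- move=> x _; have Dx0 := D_gt0 x.
  have dV : is_derive x (1 : R) (fun y => (D y)^-1) (- (D x) ^- 2 *: (p * expR x)).
    exact: (is_deriveV (lt0r_neq0 Dx0) (dD x)).
  rewrite /f; apply: is_derive_eq.
  by rewrite /= /GRing.scale/=; field; lra.
- move=> x _; have Dx0 := D_gt0 x.
  rewrite subr_ge0 ler_pdivrMr ?exprn_gt0// /D.
  (* [D x ^+ 2 - 4 * (1 - p) * p * expR x] is exactly this square. *)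
  have := sqr_ge0 (1 - p - p * expR x); lra.
Qed.

(** Differentiating the quotient of the two sides, rather than its logarithm, gives a positive
    factor times the quantity of [slope_ge0]. The sign in [f] makes it nondecreasing. *)
Lemma centered_bernoulli_mgf (h : R) : 0 <= h ->
  1 - p + p * expR h <= expR (h ^+ 2 / 8 + p * h).
Proof.
move=> h0.
pose f (x : R) : R := - (D x * expR (- (x ^+ 2 / 8) - p * x)).
have f0 : f 0 = -1.
  by rewrite /f /D expR0 expr0n/= !mul0r mulr0 subr0 oppr0 expR0; ring.
suff : f 0 <= f h.
  by rewrite f0 lerN2 -opprD expRN ler_pdivrMr ?expR_gt0// mul1r.
apply: (@le_of_is_derive_ge0 _ f (fun x => D x *
  expR (- (x ^+ 2 / 8) - p * x) * (x / 4 + p - 1 + (1 - p) / D x)) _ _ _ h0).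
- move=> x _; have Dx0 := D_gt0 x.
  rewrite /f; apply: is_derive_eq.
  rewrite /= /GRing.scale/= /D; field.
  by rewrite -/(D x); lra.
- move=> x x0; apply: mulr_ge0; last exact: slope_ge0.
  by rewrite mulr_ge0 ?expR_ge0// ltW.
Qed.
End centered_bernoulli.

(* Factor out [expR a] and take [p = - a / (b - a)], [h = b - a] above. *)
Lemma hoeffding_endpoints (R : realType) (a b : R) : a < 0 < b ->
  (b * expR a - a * expR b) / (b - a) <= expR ((b - a) ^+ 2 / 8).
Proof.
move=> /andP[a0 b0].
have ba0 : 0 < b - a by lra.
have p01 : 0 < - a / (b - a) < 1.
  by rewrite ltr_pdivrMr// divr_gt0/=; lra.
have := @centered_bernoulli_mgf R _ p01 (b - a) (ltW ba0).
rewrite divfK ?gt_eqF//.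
rewrite -(ler_pM2r (expR_gt0 a)) -[leRHS]expRD subrK.
apply: le_trans; rewrite le_eqVlt; apply/orP; left; apply/eqP.
rewrite expRD expRN; field.
by rewrite !gt_eqF ?expR_gt0.
Qed.

Section multiplicative_systems.
Context d (T : measurableType d) (R : realType) (P : probability T R).

Lemma ae_bounded_integrable (f : T -> R) (M : R) : measurable_fun [set: T] f ->
  {ae P, forall x, `|f x| <= M} -> P.-integrable [set: T] (EFin \o f).
Proof.
move=> mf fM; apply/integrableP; split; first exact/measurable_EFinP.
(* With [|M|] the dominating constant is nonnegative whatever the sign of [M]. *)
apply: (@le_lt_trans _ _ (\int[P]_x (cst `|M|%:E) x)%E).
  apply: ae_ge0_le_integral => //.
  - by apply: measurableT_comp => //; exact/measurable_EFinP.
  - by move=> x _; rewrite lee_fin.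
  - by apply: filterS fM => x fxM _ /=; rewrite lee_fin (le_trans fxM)// ler_norm.
by rewrite integral_cst//= probability_setT mule1 ltry.
Qed.

Lemma integrable_prod_ae_bounded (I : finType) (S : {set I}) (f : I -> {RV P >-> R}) :
  (forall i, exists M : R, {ae P, forall x, `|f i x| <= M}) ->
  P.-integrable [set: T] (fun x => (\prod_(i in S) f i x)%:E).
Proof.
move=> /choice[M fM].
apply: (@ae_bounded_integrable (fun x => \prod_(i in S) f i x) (\prod_(i in S) M i)).
  under eq_fun do rewrite -big_filter.
  by apply: measurable_prod => i _.
have fM_all : {ae P, forall x i, `|f i x| <= M i} by exact: filter_forall.
apply: filterS fM_all => x fMx.
by rewrite normr_prod; apply: ler_prod => i _; rewrite normr_ge0/= fMx.
Qed.

Lemma integral_prod_affine n (phi : 'I_n -> {RV P >-> R}) (a b : 'I_n -> R) :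
  multiplicative_system phi ->
  (\int[P]_x (\prod_(k < n) (a k + b k * phi k x))%:E = (\prod_(k < n) a k)%:E)%E.
Proof.
move=> [bphi Ephi].
(* [S] records the factors that contribute their linear term, so [c S] is the coefficient of
   [\prod_(k in S) phi k x]. *)
pose c (S : {set 'I_n}) := \prod_(k in S) b k * \prod_(k in ~: S) a k.
have expand x : (\prod_(k < n) (a k + b k * phi k x))%:E =
    (\sum_(S : {set 'I_n}) (c S)%:E * (\prod_(k in S) phi k x)%:E)%E.
  under eq_bigr do rewrite addrC.
  rewrite bigA_distr -sumEFin; apply: eq_bigr => S _.
  rewrite -EFinM; congr EFin; rewrite /c mulrAC -big_split/=.
  rewrite (bigID (mem S))/=; congr (_ * _).
    by apply: eq_bigr => k ->.
  by apply: eq_big => [k|k /negbTE->//]; rewrite inE.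
under eq_integral do rewrite expand.
have intS S := @integrable_prod_ae_bounded _ S _ bphi.
rewrite integral_sum//; last by move=> S; exact: integrableZl.
(* Only [S = set0] survives, with coefficient [\prod_k a k]. *)
rewrite (bigD1 finset.set0)//= big1 => [|S S0]; rewrite integralZl//.
  rewrite adde0.
  under eq_integral do rewrite big_set0.
  rewrite integral_cst//= probability_setT /c big_set0 !mule1 mul1r.
  by congr EFin; apply: eq_bigl => k; rewrite !inE.
by have := Ephi S S0; rewrite unlock => ->; rewrite mule0.
Qed.

Lemma mgf_sum_multiplicative n (A B : 'I_n -> R) (phi : 'I_n -> {RV P >-> R}) (t : R) :
  (forall k, A k < 0 < B k) -> multiplicative_system phi ->
  (forall k, {ae P, forall x, A k <= phi k x <= B k}) -> 0 < t ->
  ('E_P[fun x => expR ((\sum_(k < n) phi k x) * t)] <=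
    (expR (t ^+ 2 * (\sum_(k < n) (B k - A k) ^+ 2) / 8))%:E)%E.
Proof.
move=> AB mphi ABphi t0; rewrite unlock.
(* [a k + b k * y] is the chord of [expR] over [[t * A k, t * B k]], used at [y = t * phi k x]. *)
pose a k := (t * B k * expR (t * A k) - t * A k * expR (t * B k)) / (t * B k - t * A k).
pose b k := (expR (t * B k) - expR (t * A k)) / (t * B k - t * A k).
pose g x := \prod_(k < n) (a k + b k * t * phi k x).
have mg : measurable_fun [set: T] g.
  apply: measurable_prod => k _; apply: measurable_funD => //.
  exact: measurable_funM.
have le_g : {ae P, forall x, expR ((\sum_(k < n) phi k x) * t) <= g x}.
  have ABphi_all : {ae P, forall x k, A k <= phi k x <= B k} by exact: filter_forall.
  apply: filterS ABphi_all => x ABx.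
  rewrite mulrC mulr_sumr expR_sum; apply: ler_prod => k _; rewrite expR_ge0/= -mulrA.
  have /andP[Ak Bk] := AB k; have /andP[Ax Bx] := ABx k.
  apply: expR_le_chord; rewrite ?ltr_pM2l ?ler_pM2l ?Ax//.
  exact: lt_trans Bk.
(* [g] is nonnegative only almost everywhere, whereas the comparison of integrals asks for it
   everywhere. The absolute value is inserted here and removed by almost everywhere equality. *)
apply: (@le_trans _ _ (\int[P]_x `|(g x)%:E|)%E).
  apply: ae_ge0_le_integral => //.
  - apply/measurable_EFinP; apply: measurableT_comp => //.
    by apply: measurable_funM => //; exact: measurable_sum.
  - by apply: measurableT_comp => //; exact/measurable_EFinP.
  - by apply: filterS le_g => x gx _; rewrite lee_fin (le_trans gx)// ler_norm.
rewrite (@ae_eq_integral _ _ _ P setT (EFin \o g))//; first last.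
- apply: filterS le_g => x gx _ /=.
  by rewrite ger0_norm// (le_trans _ gx)// expR_ge0.
- exact/measurable_EFinP.
- by apply: measurableT_comp => //; exact/measurable_EFinP.
rewrite integral_prod_affine// lee_fin mulr_sumr mulr_suml expR_sum.
apply: ler_prod => k _; have /andP[Ak Bk] := AB k.
have tA : t * A k < 0 by rewrite pmulr_rlt0.
have tB : 0 < t * B k by rewrite mulr_gt0.
(* Multiplying the factorwise bounds also requires [0 <= a k], which follows from
   [A k < 0 < B k]. *)
apply/andP; split.
  rewrite divr_ge0 ?subr_ge0 ?(le_trans (ltW tA)) ?(ltW tB)//.
  by rewrite (@le_trans _ _ 0)// ?nmulr_rle0 ?pmulr_rge0 ?expR_ge0.
rewrite (_ : t ^+ 2 * _ / 8 = (t * B k - t * A k) ^+ 2 / 8); last by ring.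
by apply: hoeffding_endpoints; rewrite tA.
Qed.
End multiplicative_systems.

Theorem corollary1p4 (d : measure_display) (T : measurableType d)
    (R : realType) (P : probability T R) (n : nat) (A B : 'I_n -> R)
    (phi : 'I_n -> {RV P >-> R})
    (hAB : forall k : 'I_n, A k < 0 < B k)
    (hphi : multiplicative_system phi)
    (hbound : forall k : 'I_n, {ae P, forall x, A k <= phi k x <= B k})
    (lambda : R) (hlambda : 0 < lambda) :
  (P [set x | ((\sum_(k < n) phi k x) > lambda)%R]
    <= (expR (- (2 * lambda ^+ 2 / \sum_(k < n) (B k - A k) ^+ 2))%R)%:E)%E.
Proof.
(* For [n = 0] the denominator vanishes and [t] below would be [0]; the event is then empty. *)
have [n0|n_gt0] := posnP n.
  subst n; rewrite (_ : [set x | _] = set0) ?measure0 ?lee_fin ?expR_ge0//.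
  by apply/seteqP; split => x //=; rewrite big_ord0 ltNge (ltW hlambda).
set V := \sum_(k < n) (B k - A k) ^+ 2.
have V0 : 0 < V.
  rewrite /V (bigD1 (Ordinal n_gt0))//= ltr_pwDl ?sumr_ge0// => [|k _]; last exact: sqr_ge0.
  by rewrite exprn_gt0// subr_gt0; case/andP: (hAB (Ordinal n_gt0)) => /lt_trans; apply.
have mS : measurable_fun [set: T] (fun x => \sum_(k < n) phi k x).
  exact: measurable_sum.
pose S : {RV P >-> R} := HB.pack (fun x => \sum_(k < n) phi k x)
  (isMeasurableFun.Build _ _ _ _ _ mS).
(* This [t] minimizes the exponent [t ^+ 2 * V / 8 - t * lambda], with minimum
   [- (2 * lambda ^+ 2 / V)]. *)
pose t := 4 * lambda / V.
have t0 : 0 < t by rewrite divr_gt0// mulr_gt0.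
(* Chernoff's bound concerns the larger event with a non-strict inequality. *)
apply: (@le_trans _ _ (P [set x | S x >= lambda])).
  apply: le_measure; rewrite ?inE.
  - rewrite -[X in measurable X]setTI; exact: measurable_fun_ltr.
  - rewrite -[X in measurable X]setTI; exact: measurable_fun_ler.
  - by move=> x /= /ltW.
apply: (le_trans (chernoff _ _ t0)).
apply: (@le_trans _ _ ((expR (t ^+ 2 * V / 8))%:E * (expR (- (t * lambda)))%:E)%E).
  rewrite lee_pmul2r ?lte_fin ?expR_gt0//.
  exact: mgf_sum_multiplicative.
rewrite -EFinM -expRD lee_fin ler_expR le_eqVlt; apply/orP; left; apply/eqP.
by rewrite /t; field; lra.
Qed.
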